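(* Let $f:\mathbb{R}^n\to\mathbb{R}$ be $L$-smooth and $\mu$-strongly convex with $\mu\ge0$ ($\mu=0$ meaning convex), with nonempty set of minimizers $\mathcal{X}^\star$, and let $\mathcal{P}\subseteq\mathbb{R}^{n\times n}$ be a closed convex set with $0\in\mathcal{P}$, $L^{-1}I\in\mathcal{P}$ and $\mathrm{diam}(\mathcal{P})\le D$, $D>0$. Let $K\ge1$, $x^1\in\mathbb{R}^n$, $P_1\in\mathcal{P}$, and let $\{x^k\},\{P_k\}$ be generated by OSGM-H with stepsize $\eta=\frac{2D}{(LD+1)\sqrt K}$. Assume $x^1,\dots,x^K\notin\mathcal{X}^\star$. Put $\theta_K^\star:=\min_{P\in\mathcal{P}}\frac1K\sum_{k=1}^Kh_{x^k}(P)$ and $\rho_K:=2D(LD+1)\sqrt K$. (i) If $\mu>0$, then $$f(x^{K+1})-f(x^\star)\le(f(x^1)-f(x^\star))\Big(1-2\mu\max\big\{-\theta_K^\star-\tfrac{\rho_K}{K},0\big\}\Big)^K.$$ (ii) If $\mu\ge0$, then $$\min_{1\le k\le K}\|\nabla f(x^k)\|^2\le\frac{f(x^1)-f(x^\star)}{K}\cdot\frac1{\max\{-\theta_K^\star-\frac{\rho_K}{K},0\}},$$ $$f(x^{K+1})-f(x^\star)\le\frac{\Delta^2}{K}\cdot\frac1{\max\{-\theta_K^\star-\frac{\rho_K}{K},0\}}.$$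
   Context: Norms: $\|\cdot\|$ is the Euclidean norm of vectors; $\|\cdot\|_F$ is the Frobenius norm; $\mathrm{diam}(\mathcal{P})=\sup_{P,Q\in\mathcal{P}}\|P-Q\|_F$. Assumptions on $f$: $f$ is twice differentiable; $L$-smooth means $|f(x)-f(y)-\langle\nabla f(y),x-y\rangle|\le\frac L2\|x-y\|^2$ for all $x,y$; $\mu$-strongly convex means $f(x)-f(y)-\langle\nabla f(y),x-y\rangle\ge\frac\mu2\|x-y\|^2$ for all $x,y$. $f(x^\star)=\min f$. $\Delta:=\max_{x:\,f(x)\le f(x^1)}\min_{x^\star\in\mathcal{X}^\star}\|x-x^\star\|$. Convention: when a denominator equals $0$ the right-hand side is $+\infty$. Hypergradient surrogate: for $x\notin\mathcal{X}^\star$, $h_x(P):=\dfrac{f(x-P\nabla f(x))-f(x)}{\|\nabla f(x)\|^2}$, with gradient in $P$: $\nabla h_x(P)=-\dfrac{\nabla f(x-P\nabla f(x))\nabla f(x)^\top}{\|\nabla f(x)\|^2}$. OSGM-H: for $k=1,2,\dots$: $x^{k+1}=\mathcal{M}_{P_k}(x^k)$ and $P_{k+1}=\Pi_{\mathcal{P}}[P_k-\eta\nabla h_{x^k}(P_k)]$, where $\Pi_{\mathcal{P}}$ is the orthogonal projection onto $\mathcal{P}$ (Frobenius inner product) and $\mathcal{M}_P:\mathbb{R}^n\to\mathbb{R}^n$ is any monotone descent oracle for the function value gap, i.e. any map with $f(\mathcal{M}_P(x))\le\min\{f(x),f(x-P\nabla f(x))\}$ for all $x$. *)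

(* Defs.v *)
From HB Require Import structures.
From mathcomp Require Import all_boot all_order all_algebra.
From mathcomp Require Import all_classical all_reals all_analysis.

Set Implicit Arguments.
Unset Strict Implicit.
Unset Printing Implicit Defensive.

Import Order.TTheory GRing.Theory Num.Theory.
Import numFieldNormedType.Exports.

Local Open Scope classical_set_scope.
Local Open Scope ring_scope.

Section EuclideanStructure.
Context {R : realType} {m n : nat}.
Implicit Types A B : 'M[R]_(m, n).

(* For n = 1 these are the Euclidean inner product and norm of column vectors.
   The library norm `|A| is the entrywise maximum norm: it induces the same
   topology and the same notion of differentiability, but is not the norm
   used in the quantitative statements. *)
Definition frob_inner A B : R := \sum_i \sum_j A i j * B i j.

Definition frob_norm A : R := Num.sqrt (frob_inner A A).

Definition frob_diam (Ps : set 'M[R]_(m, n)) : \bar R :=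
  ereal_sup [set (frob_norm (AB.1 - AB.2))%:E | AB in Ps `*` Ps].

(* The metric (nearest-point) projection, stated as a relation. *)
Definition is_projection (Ps : set 'M[R]_(m, n)) A B : Prop :=
  Ps B /\ forall C, Ps C -> frob_norm (A - B) <= frob_norm (A - C).

(* The matrix of partial derivatives, i.e. the gradient for [frob_inner]. *)
Definition grad (f : 'M[R]_(m, n) -> R) A : 'M[R]_(m, n) :=
  \matrix_(i, j) 'D_(delta_mx i j) f A.

End EuclideanStructure.

Section Optimization.
Context {R : realType} {n : nat}.
Implicit Types (f : 'cV[R]_n -> R) (x y : 'cV[R]_n) (P : 'M[R]_n).

Definition twice_differentiable f : Prop :=
  (forall x, differentiable f x) /\ (forall x, differentiable (grad f) x).

Definition smooth (L : R) f : Prop := forall x y,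
  `|f x - f y - frob_inner (grad f y) (x - y)| <= L / 2 * frob_norm (x - y) ^+ 2.

Definition strongly_convex (mu : R) f : Prop := forall x y,
  mu / 2 * frob_norm (x - y) ^+ 2 <= f x - f y - frob_inner (grad f y) (x - y).

Definition minimizers f : set 'cV[R]_n := [set x | forall y, f x <= f y].

Definition dist_minimizers f x : \bar R :=
  ereal_inf [set (frob_norm (x - y))%:E | y in minimizers f].

(* May be +oo when f is not strongly convex. *)
Definition level_radius f x1 : \bar R :=
  ereal_sup [set dist_minimizers f x | x in [set x | f x <= f x1]].

Definition hsurrogate f x P : R :=
  (f (x - P *m grad f x) - f x) / frob_norm (grad f x) ^+ 2.

Definition monotone_descent_oracle f P (M : 'cV[R]_n -> 'cV[R]_n) : Prop :=
  forall x, f (M x) <= Num.min (f x) (f (x - P *m grad f x)).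

(* Indices start at 1; the values x 0 and P 0 are irrelevant.  The recursion
   is only required for the steps k = 1, ..., K, at which h_{x^k} has to be
   defined. *)
Definition OSGM_H f (Ps : set 'M[R]_n) (M : 'M[R]_n -> 'cV[R]_n -> 'cV[R]_n)
    (eta : R) (K : nat) (x : nat -> 'cV[R]_n) (P : nat -> 'M[R]_n) : Prop :=
  forall k, (1 <= k <= K)%N ->
    x k.+1 = M (P k) (x k) /\
    is_projection Ps (P k - eta *: grad (hsurrogate f (x k)) (P k)) (P k.+1).

(* A minimum in the intended use: Ps is compact and h_x is continuous. *)
Definition theta_star f (Ps : set 'M[R]_n) (K : nat) (x : nat -> 'cV[R]_n) : R :=
  inf [set K%:R^-1 * \sum_(1 <= k < K.+1) hsurrogate f (x k) P | P in Ps].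

Lemma grad_hsurrogateE f x P : differentiable f (x - P *m grad f x) ->
  grad (hsurrogate f x) P =
  - ((frob_norm (grad f x) ^+ 2)^-1 *:
       (grad f (x - P *m grad f x) *m (grad f x)^T)).
Proof.
set g := grad f x; set y := x - P *m g => fy.
have shiftE (h : R) i j : x - (h *: delta_mx i j + P) *m g =
    h *: - (g j 0 *: delta_mx i 0) + y.
  have -> : g j 0 *: delta_mx i 0 = delta_mx i j *m g :> 'cV[R]_n.
    apply/matrixP => a b; rewrite (ord1 b) !mxE (bigD1 j) //= !mxE !eqxx !andbT.
    rewrite big1 ?addr0 1?mulrC // => k kj.
    by rewrite !mxE (negPf kj) andbF mul0r.
  by rewrite mulmxDl -scalemxAl scalerN /y addrCA opprD.
have fP i j : derivable (fun Q => f (x - Q *m g)) P (delta_mx i j) /\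
    'D_(delta_mx i j) (fun Q => f (x - Q *m g)) P = - (g j 0 * grad f y i 0).
  have eqf : (fun h : R => h^-1 *: (((fun Q => f (x - Q *m g)) \o shift P)
                 (h *: delta_mx i j) - f (x - P *m g))) =
      (fun h : R => h^-1 *: ((f \o shift y)
                 (h *: - (g j 0 *: delta_mx i 0)) - f y)).
    by apply/funext => h; rewrite /= shiftE.
  split; first by rewrite /derivable eqf; exact: diff_derivable.
  rewrite /derive eqf -/(derive f y _) deriveE // linearN linearZ /=.
  by rewrite -deriveE // !mxE.
apply/matrixP => i j; have [dfP DfP] := fP i j.
rewrite mxE; have -> : hsurrogate f x = (frob_norm g ^+ 2)^-1 \*:
    ((fun Q => f (x - Q *m g)) - cst (f x)).
  by apply/funext => Q; rewrite /hsurrogate mulrC.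
rewrite deriveZ; last by apply: derivableB => //; exact: derivable_cst.
rewrite deriveB //.
rewrite derive_cst subr0 DfP !mxE big_ord1 !mxE scalerN; congr (- (_ * _)).
by rewrite mulrC.
Qed.

End Optimization.

(* a / b with the convention that the quotient is +oo when b = 0. *)
Definition ediv_infty {R : realType} (a : \bar R) (b : R) : \bar R :=
  if b == 0 then +oo%E else (a * (b^-1)%:E)%E.

(* Main.v *)
(* Projected online gradient descent on the convex functions [h_{x^k}], whose
   gradients are bounded by [L D + 1], has regret at most [rho_K], hence the
   average of [h_{x^k}(P_k)] is at most [theta_K + rho_K / K].  Since the oracle
   is monotone, step [k] decreases [f] by at least [a_k |grad f(x^k)|^2] with
   [a_k = max (- h_{x^k}(P_k), 0)], and the [a_k] add up to at least [K gain].
   The three rates then follow by bounding [|grad f(x^k)|^2] from below by,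
   respectively, the Polyak-Lojasiewicz inequality (with AM-GM on the product of
   contraction factors), the smallest gradient, and [(gap_k / Delta)^2]. *)

Require Import Defs.
From mathcomp Require Import all_boot all_order all_algebra.
From mathcomp Require Import all_classical all_reals all_analysis.
From mathcomp Require Import ring lra.

Set Implicit Arguments.
Unset Strict Implicit.
Unset Printing Implicit Defensive.

Import Order.TTheory GRing.Theory Num.Theory.
Import numFieldNormedType.Exports.

Local Open Scope classical_set_scope.
Local Open Scope ring_scope.

(** * The Frobenius inner product: bilinearity, Cauchy-Schwarz and the triangle inequality *)

Section FrobeniusInner.
Context {R : realType} {m n : nat}.
Implicit Types (A B C : 'M[R]_(m, n)) (c : R).

Lemma frob_innerC A B : frob_inner A B = frob_inner B A.
Proof. by apply: eq_bigr => i _; apply: eq_bigr => j _; rewrite mulrC. Qed.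

Lemma frob_innerDl A B C :
  frob_inner (A + B) C = frob_inner A C + frob_inner B C.
Proof.
rewrite /frob_inner -big_split; apply: eq_bigr => i _.
by rewrite -big_split; apply: eq_bigr => j _; rewrite mxE mulrDl.
Qed.

Lemma frob_innerZl c A B : frob_inner (c *: A) B = c * frob_inner A B.
Proof.
rewrite /frob_inner mulr_sumr; apply: eq_bigr => i _.
by rewrite mulr_sumr; apply: eq_bigr => j _; rewrite mxE mulrA.
Qed.

Lemma frob_innerNl A B : frob_inner (- A) B = - frob_inner A B.
Proof. by rewrite -scaleN1r frob_innerZl mulN1r. Qed.

Lemma frob_innerDr A B C :
  frob_inner C (A + B) = frob_inner C A + frob_inner C B.
Proof. by rewrite frob_innerC frob_innerDl !(frob_innerC C). Qed.

Lemma frob_innerZr c A B : frob_inner A (c *: B) = c * frob_inner A B.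
Proof. by rewrite frob_innerC frob_innerZl frob_innerC. Qed.

Lemma frob_innerNr A B : frob_inner A (- B) = - frob_inner A B.
Proof. by rewrite frob_innerC frob_innerNl frob_innerC. Qed.

Definition frob_bilin := (frob_innerDl, frob_innerDr, frob_innerNl,
  frob_innerNr, frob_innerZl, frob_innerZr).

Lemma frob_inner_ge0 A : 0 <= frob_inner A A.
Proof.
by apply: sumr_ge0 => i _; apply: sumr_ge0 => j _; rewrite -expr2 sqr_ge0.
Qed.

Lemma frob_inner_eq0 A : (frob_inner A A == 0) = (A == 0).
Proof.
apply/idP/eqP => [|->]; last by rewrite -(scale0r 0) frob_innerZl mul0r.
rewrite psumr_eq0 => [/allP A0|i _]; last first.
  by apply: sumr_ge0 => j _; rewrite -expr2 sqr_ge0.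
apply/matrixP => i j; have := A0 i (mem_index_enum i).
rewrite psumr_eq0 => [/allP/(_ j (mem_index_enum j))|k _].
  by rewrite /= -expr2 sqrf_eq0 mxE => /eqP.
by rewrite -expr2 sqr_ge0.
Qed.

Lemma sqr_frob_norm A : frob_norm A ^+ 2 = frob_inner A A.
Proof. by rewrite sqr_sqrtr // frob_inner_ge0. Qed.

Lemma frob_norm_ge0 A : 0 <= frob_norm A.
Proof. exact: sqrtr_ge0. Qed.

Lemma ler_frob_norm A B :
  (frob_norm A <= frob_norm B) = (frob_inner A A <= frob_inner B B).
Proof. by rewrite ler_sqrt // frob_inner_ge0. Qed.

Lemma frob_cauchy_schwarz A B :
  frob_inner A B ^+ 2 <= frob_inner A A * frob_inner B B.
Proof.
have [/eqP|B0] := eqVneq (frob_inner B B) 0.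
  by rewrite frob_inner_eq0 => /eqP ->; rewrite -(scale0r 0) !frob_bilin; lra.
have Bp : 0 < frob_inner B B by rewrite lt_def B0 frob_inner_ge0.
rewrite -subr_ge0 -(pmulr_rge0 _ Bp).
(* The squared norm of this combination is [frob_inner B B] times the deficit in the inequality. *)
have := frob_inner_ge0 (frob_inner B B *: A - frob_inner A B *: B).
rewrite !frob_bilin (frob_innerC B A); congr (0 <= _); ring.
Qed.

Lemma frob_cauchy_schwarz_norm A B :
  frob_inner A B <= frob_norm A * frob_norm B.
Proof.
apply: (le_trans (ler_norm _)).
rewrite -(ler_pXn2r (n := 2)) ?nnegrE ?mulr_ge0 ?frob_norm_ge0 //.
by rewrite real_normK ?num_real // exprMn !sqr_frob_norm frob_cauchy_schwarz.
Qed.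

Lemma frob_inner_sqrB A B :
  frob_inner (A - B) (A - B) =
  frob_inner A A - 2 * frob_inner A B + frob_inner B B.
Proof. by rewrite !frob_bilin (frob_innerC B A); ring. Qed.

Lemma ler_frob_normD A B : frob_norm (A + B) <= frob_norm A + frob_norm B.
Proof.
rewrite -(ler_pXn2r (n := 2)) ?nnegrE ?addr_ge0 ?frob_norm_ge0 //.
rewrite sqrrD !sqr_frob_norm !frob_bilin (frob_innerC B A).
have := frob_cauchy_schwarz_norm A B; lra.
Qed.

End FrobeniusInner.

(** * The Frobenius norm and matrix products *)

Lemma frob_inner_mulmxl (R : realType) m n p (A : 'M[R]_(m, n))
    (B : 'M[R]_(n, p)) (C : 'M[R]_(m, p)) :
  frob_inner (A *m B) C = frob_inner A (C *m B^T).
Proof.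
apply: eq_bigr => i _; under eq_bigr do rewrite mxE mulr_suml.
rewrite exchange_big; apply: eq_bigr => j _; rewrite mxE mulr_sumr.
by apply: eq_bigr => k _; rewrite !mxE; ring.
Qed.

Lemma frob_inner_outer (R : realType) m n (u : 'cV[R]_m) (v : 'cV[R]_n) :
  frob_inner (u *m v^T) (u *m v^T) = frob_inner u u * frob_inner v v.
Proof.
rewrite /frob_inner mulr_suml; apply: eq_bigr => i _.
rewrite big_ord1 mulr_sumr; apply: eq_bigr => j _.
by rewrite !mxE !big_ord1 !mxE; ring.
Qed.

(** Cauchy-Schwarz for each row of [A] against [v], summed over the rows. *)
Lemma frob_norm_mulmx (R : realType) m n (A : 'M[R]_(m, n)) (v : 'cV[R]_n) :
  frob_norm (A *m v) <= frob_norm A * frob_norm v.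
Proof.
rewrite -(ler_pXn2r (n := 2)) ?nnegrE ?mulr_ge0 ?frob_norm_ge0 //.
rewrite exprMn !sqr_frob_norm {1 2}/frob_inner mulr_suml.
apply: ler_sum => i _; rewrite big_ord1 -expr2.
have -> : (A *m v) i 0 = frob_inner (row i A) v^T.
  by rewrite !mxE /frob_inner big_ord1; apply: eq_bigr => j _; rewrite !mxE.
have <- : frob_inner (row i A) (row i A) = \sum_j A i j * A i j.
  by rewrite /frob_inner big_ord1; apply: eq_bigr => j _; rewrite !mxE.
have <- : frob_inner v^T v^T = frob_inner v v.
  rewrite /frob_inner big_ord1; apply: eq_bigr => j _.
  by rewrite !mxE big_ord1.
exact: frob_cauchy_schwarz.
Qed.

Lemma frob_normN (R : realType) m n (A : 'M[R]_(m, n)) :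
  frob_norm (- A) = frob_norm A.
Proof. by rewrite /frob_norm frob_innerNl frob_innerNr opprK. Qed.

Lemma frob_normZ (R : realType) m n c (A : 'M[R]_(m, n)) :
  frob_norm (c *: A) = `|c| * frob_norm A.
Proof.
rewrite /frob_norm frob_innerZl frob_innerZr mulrA -expr2 sqrtrM ?sqr_ge0 //.
by rewrite sqrtr_sqr.
Qed.

Lemma frob_norm_outer (R : realType) m n (u : 'cV[R]_m) (v : 'cV[R]_n) :
  frob_norm (u *m v^T) = frob_norm u * frob_norm v.
Proof. by rewrite /frob_norm frob_inner_outer sqrtrM // frob_inner_ge0. Qed.

(** * Projection onto a convex set and the regret of projected gradient descent *)

Section Projection.
Context {R : realType} {m n : nat}.
Implicit Types (A B C : 'M[R]_(m, n)) (Ps : set 'M[R]_(m, n)).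

Lemma convex_set_segment Ps B C (t : R) : @convex_set R 'M[R]_(m, n) Ps ->
  Ps B -> Ps C -> 0 <= t <= 1 -> Ps (B + t *: (C - B)).
Proof.
move=> cPs PB PC /andP[t0 t1].
have := cPs C B (Itv01 t0 t1); rewrite !inE => /(_ PC PB); congr (Ps _).
rewrite /conv /= /unstable.onem scalerBl scale1r scalerBr.
by rewrite addrC addrAC addrA.
Qed.

(** Variational inequality of the projection: were the inner product positive, a short move from [B]
    towards [C] would come closer to [A]. *)
Lemma projection_obtuse Ps A B C : @convex_set R 'M[R]_(m, n) Ps ->
  is_projection Ps A B -> Ps C -> frob_inner (A - B) (C - B) <= 0.
Proof.
move=> cPs [PB prB] PC; rewrite leNgt; apply/negP => s0.
set s := frob_inner _ _ in s0; set q := frob_inner (C - B) (C - B).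
have q0 : 0 <= q := frob_inner_ge0 _.
have step t : 0 <= t <= 1 -> 2 * t * s <= t ^+ 2 * q.
  move=> t01; have := prB _ (convex_set_segment cPs PB PC t01).
  rewrite ler_frob_norm opprD addrA [leRHS]frob_inner_sqrB frob_innerZl.
  by rewrite !frob_innerZr -/q -/s; lra.
have qs0 : 0 < q + s by lra.
(* Unlike the optimal [s / q], this step length stays in [0, 1] and allows [q = 0]. It satisfies
   [t * q <= s], so [step] divided by [t] yields [2 * s <= s]. *)
have t01 : 0 <= s / (q + s) <= 1.
  rewrite divr_ge0 ?(ltW s0) ?(ltW qs0) //=.
  by rewrite ler_pdivrMr // mul1r lerDr.
have t0 : 0 < s / (q + s) by rewrite divr_gt0.
have tq : s / (q + s) * q <= s.
  by rewrite mulrAC ler_pdivrMr // ler_pM2l // lerDl ltW.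
move: (step _ t01); move: (s / (q + s)) t0 tq => t t0 tq.
rewrite [2 * t]mulrC expr2 -!mulrA ler_pM2l // => ts.
by have := le_trans ts tq; lra.
Qed.

(** Expanding the square of [(A - B) - (C - B)], the cross term has the right sign by the obtuse
    angle at [B]. *)
Lemma projection_le Ps A B C : @convex_set R 'M[R]_(m, n) Ps ->
  is_projection Ps A B -> Ps C ->
  frob_inner (B - C) (B - C) <= frob_inner (A - C) (A - C).
Proof.
move=> cPs prB PC; have := projection_obtuse cPs prB PC.
have -> : A - C = (A - B) - (C - B) by rewrite opprB addrA subrK.
rewrite -(opprB C B) frob_innerNl frob_innerNr opprK frob_inner_sqrB.
by have := frob_inner_ge0 (A - B); lra.
Qed.

(** The squared distance to [C] is the potential: projecting does not increase it, and expanding the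
    unprojected step bounds [2 * eta] times the regret of step [k] by its decrease plus
    [(eta * gam) ^+ 2]. *)
Lemma ogd_regret (Ps : set 'M[R]_(m, n)) (h : nat -> 'M[R]_(m, n) -> R)
    (P G : nat -> 'M[R]_(m, n)) (eta gam : R) (K : nat) C :
  @convex_set R 'M[R]_(m, n) Ps -> 0 <= eta -> Ps C ->
  (forall k, (1 <= k <= K)%N ->
    [/\ h k (P k) - h k C <= frob_inner (G k) (P k - C),
        frob_norm (G k) <= gam &
        is_projection Ps (P k - eta *: G k) (P k.+1)]) ->
  2 * eta * \sum_(1 <= k < K.+1) (h k (P k) - h k C) <=
    frob_norm (P 1%N - C) ^+ 2 + K%:R * (eta * gam) ^+ 2.
Proof.
move=> cPs eta0 PC step.
(* Negated, so that [d k.+1 - d k] is the decrease in squared distance; the sum telescopes and the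
   final distance is dropped. *)
pose d k := - frob_norm (P k - C) ^+ 2.
have -> : K%:R * (eta * gam) ^+ 2 = \sum_(1 <= k < K.+1) (eta * gam) ^+ 2.
  by rewrite sumr_const_nat subSS subn0 mulr_natl.
suff : \sum_(1 <= k < K.+1) (2 * eta * (h k (P k) - h k C)) <=
    \sum_(1 <= k < K.+1) ((d k.+1 - d k) + (eta * gam) ^+ 2).
  rewrite -mulr_sumr [X in _ <= X -> _]big_split /= telescope_sumr // /d.
  by have := sqr_ge0 (frob_norm (P K.+1 - C)); lra.
apply: ler_sum_nat => k /step[hk Gk prk].
have G2 : frob_inner (G k) (G k) <= gam ^+ 2.
  have gam0 : 0 <= gam := le_trans (frob_norm_ge0 _) Gk.
  by rewrite -sqr_frob_norm lerXn2r ?nnegrE ?frob_norm_ge0.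
rewrite /d !sqr_frob_norm; have := projection_le cPs prk PC.
rewrite addrAC; move: (P k - C) (P k.+1 - C) hk => U V hk.
rewrite frob_inner_sqrB frob_innerZl !frob_innerZr (frob_innerC U) exprMn.
have := ler_wpM2l eta0 hk; have := ler_wpM2l (sqr_ge0 eta) G2.
by rewrite !expr2; lra.
Qed.

End Projection.

(** * Gradient inequalities for smooth convex functions, and the surrogate in [P] *)

Section ConvexFunction.
Context {R : realType} {n : nat}.
Variable f : 'cV[R]_n -> R.
Implicit Types (x y : 'cV[R]_n) (P Q : 'M[R]_n) (mu L D : R).

Lemma strongly_convexW mu x y : 0 <= mu -> strongly_convex mu f ->
  frob_inner (grad f y) (x - y) <= f x - f y.
Proof.
move=> mu0 /(_ x y); rewrite sqr_frob_norm -subr_ge0 => fxy.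
by have := mulr_ge0 mu0 (frob_inner_ge0 (x - y)); lra.
Qed.

Lemma grad0_minimizers mu x : 0 <= mu -> strongly_convex mu f ->
  grad f x = 0 -> minimizers f x.
Proof.
move=> mu0 fmu g0 y; have := strongly_convexW y x mu0 fmu.
by rewrite g0 -(scale0r 0) frob_innerZl mul0r subr_ge0.
Qed.

Lemma gap_le_grad_dist mu x y : 0 <= mu -> strongly_convex mu f ->
  f x - f y <= frob_norm (grad f x) * frob_norm (x - y).
Proof.
move=> mu0 fmu; have := strongly_convexW y x mu0 fmu.
rewrite -(opprB x) frob_innerNr.
by have := frob_cauchy_schwarz_norm (grad f x) (x - y); lra.
Qed.

(** Strong convexity is multiplied by [mu] and combined with the nonnegative square of
    [g - mu *: (x - y)], which avoids dividing by [mu]. *)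
Lemma polyak_lojasiewicz mu x y : 0 <= mu -> strongly_convex mu f ->
  2 * mu * (f x - f y) <= frob_norm (grad f x) ^+ 2.
Proof.
move=> mu0 /(_ y x); rewrite !sqr_frob_norm; move: (grad f x) => g fyx.
have := frob_inner_ge0 (g - mu *: (x - y)); rewrite frob_inner_sqrB.
move: fyx; rewrite -(opprB x) !(frob_innerNl, frob_innerNr) opprK.
rewrite frob_innerZl !frob_innerZr => /(ler_wpM2l mu0); lra.
Qed.

(* The gradient step of length [L^-1] from [x] for the convex function
   [z |-> f z - <grad f y, z>], which is minimal at [y]. *)
Lemma grad_lipschitz mu L x y : 0 <= mu -> 0 < L ->
  strongly_convex mu f -> smooth L f ->
  frob_norm (grad f x - grad f y) <= L * frob_norm (x - y).
Proof.
move=> mu0 L0 fmu fL.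
rewrite -(ler_pXn2r (n := 2)) ?nnegrE ?mulr_ge0 ?frob_norm_ge0 ?(ltW L0) //.
rewrite exprMn !sqr_frob_norm; set d := grad f x - grad f y.
set z := x - L^-1 *: d.
have gxz : frob_inner (grad f x) (z - x) = - (L^-1 * frob_inner (grad f x) d).
  by rewrite /z addrAC subrr add0r frob_innerNr frob_innerZr.
have gyz : frob_inner (grad f y) (z - y) =
    frob_inner (grad f y) (x - y) - L^-1 * frob_inner (grad f y) d.
  by rewrite /z addrAC [LHS]frob_innerDr frob_innerNr frob_innerZr.
have zz : frob_inner (z - x) (z - x) = L^-1 * (L^-1 * frob_inner d d).
  rewrite /z addrAC subrr add0r frob_innerNl frob_innerNr opprK.
  by rewrite frob_innerZl frob_innerZr.
have fzx := le_trans (ler_norm _) (fL z x).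
have fxy := le_trans (ler_norm _) (fL x y).
have fyz := strongly_convexW z y mu0 fmu.
have dE : frob_inner (grad f x) d - frob_inner (grad f y) d = frob_inner d d.
  by rewrite {3}/d frob_innerDl frob_innerNl.
move: fzx fxy fyz; rewrite !sqr_frob_norm gxz gyz zz.
move: (f x) (f y) (f z) (frob_inner (grad f x) d) (frob_inner (grad f y) d) dE.
move: (frob_inner d d) (frob_inner (x - y) (x - y)) (frob_inner _ (x - y)).
move=> dd e c fx fy fz a b dE fzx fxy fyz.
have {}fzx : fz - fx + L^-1 * a <= L^-1 * dd / 2.
  suff <- : L / 2 * (L^-1 * (L^-1 * dd)) = L^-1 * dd / 2 by lra.
  by field; rewrite gt_eqF.
(* Chaining [fxy], [fzx] and [fyz] cancels the function values and [c]; with [a - b = dd] there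
   remains half of this inequality. *)
have : L^-1 * dd <= L * e.
  by have := congr1 ( *%R L^-1) dE; rewrite mulrBr; lra.
by rewrite ler_pdivrMl // expr2 mulrA.
Qed.

(** Up to a constant and a nonnegative factor, the surrogate is [f] composed with the affine map
    [P |-> x - P *m grad f x], hence convex. Moving [grad f x] across the inner product by
    adjointness reduces the claim to convexity of [f]. *)
Lemma hsurrogate_subgradient mu x P Q : 0 <= mu -> strongly_convex mu f ->
  differentiable f (x - P *m grad f x) ->
  hsurrogate f x P - hsurrogate f x Q <=
    frob_inner (grad (hsurrogate f x) P) (P - Q).
Proof.
move=> mu0 fmu df; rewrite grad_hsurrogateE // /hsurrogate.
set g := grad f x; set y := x - P *m g.
rewrite -mulrBl opprB addrA subrK frob_innerNl frob_innerZl.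
rewrite frob_inner_mulmxl trmxK.
rewrite mulrC -mulrN ler_wpM2l ?invr_ge0 ?sqr_ge0 //.
have := strongly_convexW (x - Q *m g) y mu0 fmu.
have -> : x - Q *m g - y = (P - Q) *m g.
  by rewrite /y mulmxBl opprB addrC addrA subrK.
by lra.
Qed.

(** The gradient is an outer product of norm [|grad f y| / |g|], with [y] the trial point; the
    Lipschitz bound and [|y - x| <= D |g|] give [|grad f y| <= (L D + 1) |g|]. *)
Lemma grad_hsurrogate_norm mu L D x P : 0 <= mu -> 0 < L ->
  strongly_convex mu f -> smooth L f ->
  differentiable f (x - P *m grad f x) -> grad f x != 0 ->
  frob_norm P <= D -> frob_norm (grad (hsurrogate f x) P) <= L * D + 1.
Proof.
move=> mu0 L0 fmu fL df; rewrite grad_hsurrogateE // => g0 PD.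
move: df; set g := grad f x in g0 *; set y := x - P *m g => df.
rewrite frob_normN frob_normZ frob_norm_outer ger0_norm ?invr_ge0 ?sqr_ge0 //.
have g_gt0 : 0 < frob_norm g.
  by rewrite sqrtr_gt0 lt_def frob_inner_eq0 g0 frob_inner_ge0.
rewrite ler_pdivrMl ?exprn_gt0 // expr2 -mulrA [X in _ <= X]mulrC.
rewrite [X in _ <= X * _]mulrC ler_pM2r //.
have -> : grad f y = g + (grad f y - g) by rewrite addrC subrK.
apply: (le_trans (ler_frob_normD _ _)).
have yg := grad_lipschitz y x mu0 L0 fmu fL.
have yx : frob_norm (y - x) <= D * frob_norm g.
  rewrite /y addrAC subrr add0r frob_normN.
  apply: (le_trans (frob_norm_mulmx _ _)).
  by rewrite ler_wpM2r // ltW.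
have := ler_wpM2l (ltW L0) yx; move: yg; rewrite -/g; lra.
Qed.

End ConvexFunction.

(** * Scalar recursions behind the three rates *)

Section Rates.
Context {R : realType}.
Implicit Types (d g a : nat -> R) (K : nat).

Lemma linear_rate d a K c : (0 < K)%N ->
  (forall k, (1 <= k <= K)%N -> 0 < d k /\ d k.+1 <= d k * (1 - a k)) ->
  0 <= d K.+1 -> K%:R * c <= \sum_(1 <= k < K.+1) a k ->
  d K.+1 <= d 1%N * (1 - c) ^+ K.
Proof.
move=> K0 dk dK ac.
have d0 k : (1 <= k <= K.+1)%N -> 0 <= d k.
  case/andP => k1; rewrite leq_eqVlt => /orP[/eqP -> //|kK].
  by rewrite ltW // (dk k _).1 // k1.
(* AM-GM needs nonnegative factors. They come from the gaps, [0 <= d k.+1 <= d k * (1 - a k)] with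
   [d k > 0], not from an upper bound on [a k]. *)
have a1 k : (1 <= k <= K)%N -> 0 <= 1 - a k.
  move=> kK; have [dk0 dkS] := dk _ kK.
  rewrite -(pmulr_rge0 _ dk0) (le_trans _ dkS) // d0 //.
  by case/andP: kK => _; rewrite ltnS.
have prod_le j : (j <= K)%N ->
    d j.+1 <= d 1%N * \prod_(1 <= k < j.+1) (1 - a k).
  elim: j => [_|j IH jK]; first by rewrite big_nil mulr1.
  rewrite big_nat_recr //= mulrA (le_trans (dk j.+1 _).2) ?jK //.
  by rewrite ler_wpM2r ?a1 ?jK // IH // ltnW.
apply: (le_trans (prod_le K (leqnn _))).
have d1 : 0 <= d 1%N by apply: d0.
apply: ler_wpM2l => //; rewrite big_add1 /= big_mkord.
have /(_ 'I_K predT (fun i : 'I_K => 1 - a i.+1)) := @leif_AGM R.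
rewrite cardT size_enum_ord => AGM.
have {}AGM := AGM (fun i _ => a1 i.+1 (ltn_ord i)).
apply: (le_trans AGM).
have m0 : 0 <= (\sum_(i < K) (1 - a i.+1)) / K%:R.
  by rewrite divr_ge0 // sumr_ge0 // => i _; apply: a1; apply: ltn_ord.
suff mc : (\sum_(i < K) (1 - a i.+1)) / K%:R <= 1 - c.
  by apply: lerXn2r; rewrite ?nnegrE // (le_trans m0).
rewrite ler_pdivrMr ?ltr0n // sumrB sumr_const card_ord mulrBl mul1r.
move: ac; rewrite big_add1 /= big_mkord; lra.
Qed.

Lemma best_iterate_rate d g a K : (0 < K)%N ->
  (forall k, (1 <= k <= K)%N -> 0 <= a k /\ d k.+1 <= d k - g k * a k) ->
  exists2 k, (1 <= k <= K)%N &
    g k * \sum_(1 <= k < K.+1) a k <= d 1%N - d K.+1.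
Proof.
case: K => // K _ dk.
(* The index minimizing [g]; the ordinal [i] stands for the iterate [i.+1]. *)
case: (arg_minP (fun i : 'I_K.+1 => g i.+1) (erefl : predT ord0)) => i _ gi.
exists i.+1; first exact: ltn_ord.
rewrite mulr_sumr -opprB -(telescope_sumr d) // -sumrN.
apply: ler_sum_nat => -[//|k] kK; have [ak dkS] := dk _ kK.
have := ler_wpM2r ak (gi (Ordinal (kK : (k < K.+1)%N)) isT) => /=; lra.
Qed.

(* [1 / d k.+1 - 1 / d k >= (d k - d k.+1) / d k ^+ 2 >= a k]. *)
Lemma sublinear_rate d a K :
  (forall k, (1 <= k <= K)%N ->
    [/\ 0 < d k, 0 <= a k & d k.+1 <= d k - d k ^+ 2 * a k]) ->
  0 <= d K.+1 -> d K.+1 * \sum_(1 <= k < K.+1) a k <= 1.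
Proof.
(* If the last value is 0 the claim is trivial; otherwise all [d k] are positive and have
   reciprocals. *)
move=> dk; rewrite le_eqVlt => /orP[/eqP <-|dK]; first by rewrite mul0r.
have d0 k : (1 <= k <= K.+1)%N -> 0 < d k.
  case/andP => k1; rewrite leq_eqVlt => /orP[/eqP -> //|kK].
  by have [] := dk k; rewrite ?k1.
rewrite -ler_pdivlMl // mulr1.
suff : \sum_(1 <= k < K.+1) a k <= (d K.+1)^-1 - (d 1%N)^-1.
  by have := d0 1%N isT; rewrite -invr_gt0; lra.
rewrite -(telescope_sumr (fun k => (d k)^-1)) //.
apply: ler_sum_nat => k kK; have [dk0 ak dkS] := dk _ kK.
have dS0 : 0 < d k.+1 by apply: d0; case/andP: kK.
have -> : (d k.+1)^-1 - (d k)^-1 = (d k - d k.+1) / (d k * d k.+1).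
  by field; rewrite !gt_eqF.
rewrite ler_pdivlMr ?mulr_gt0 //.
have dle : d k.+1 <= d k by have := mulr_ge0 (sqr_ge0 (d k)) ak; lra.
have := ler_wpM2l (mulr_ge0 ak (ltW dk0)) dle; rewrite expr2 in dkS; lra.
Qed.

End Rates.

(** * Regret and descent along a run of OSGM-H *)

Section OSGM.
Context {R : realType} {n : nat}.
Variables (f : 'cV[R]_n -> R) (L mu D : R) (Ps : set 'M[R]_n).
Variables (M : 'M[R]_n -> 'cV[R]_n -> 'cV[R]_n) (K : nat).
Variables (x : nat -> 'cV[R]_n) (P : nat -> 'M[R]_n).
Hypotheses (L0 : 0 < L) (mu0 : 0 <= mu) (D0 : 0 < D) (K0 : (0 < K)%N).
Hypotheses (df : forall z, differentiable f z).
Hypotheses (fL : smooth L f) (fmu : strongly_convex mu f).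
Hypotheses (cPs : @convex_set R 'M[R]_n Ps) (Ps0 : Ps 0).
Hypothesis PsD : (frob_diam Ps <= D%:E)%E.
Hypothesis hM : forall Q, Ps Q -> monotone_descent_oracle f Q (M Q).
Hypothesis P1 : Ps (P 1%N).
Hypothesis run : OSGM_H f Ps M (2 * D / ((L * D + 1) * Num.sqrt K%:R)) K x P.
Hypothesis hx : forall k, (1 <= k <= K)%N -> ~ minimizers f (x k).

Let a k : R := Num.max (- hsurrogate f (x k) (P k)) 0.
Let rho : R := 2 * D * (L * D + 1) * Num.sqrt K%:R.
Let gain : R := Num.max (- theta_star f Ps K x - rho / K%:R) 0.

Lemma frob_diam_le A B : Ps A -> Ps B -> frob_norm (A - B) <= D.
Proof.
move=> PA PB; rewrite -lee_fin; apply: le_trans PsD.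
by apply: ereal_sup_ubound; exists (A, B).
Qed.

Lemma osgm_mem k : (1 <= k <= K.+1)%N -> Ps (P k).
Proof.
case: k => // -[//|k] /= kK; have [_ []] := run (kK : (1 <= k.+1 <= K)%N).
by [].
Qed.

Lemma osgm_grad_neq0 k : (1 <= k <= K)%N -> grad f (x k) != 0.
Proof.
by move=> kK; apply/eqP => /(grad0_minimizers mu0 fmu); apply: hx.
Qed.

Lemma osgm_grad_gt0 k : (1 <= k <= K)%N -> 0 < frob_norm (grad f (x k)).
Proof.
move=> kK.
by rewrite sqrtr_gt0 lt_def frob_inner_eq0 osgm_grad_neq0 ?frob_inner_ge0.
Qed.

Lemma osgm_regret C : Ps C ->
  \sum_(1 <= k < K.+1) hsurrogate f (x k) (P k) - rho <=
  \sum_(1 <= k < K.+1) hsurrogate f (x k) C.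
Proof.
move=> PC; rewrite lerBlDr addrC -lerBlDr -sumrB.
set s := Num.sqrt (K%:R : R).
have s0 : 0 < s by rewrite sqrtr_gt0 ltr0n.
have s2 : s ^+ 2 = K%:R by rewrite sqr_sqrtr.
have LD0 : 0 < L * D + 1 by rewrite addr_gt0 ?mulr_gt0.
pose eta := 2 * D / ((L * D + 1) * s).
have eta0 : 0 < eta by rewrite divr_gt0 ?mulr_gt0.
have etaE : eta * ((L * D + 1) * s) = 2 * D.
  by rewrite divfK // gt_eqF // mulr_gt0.
have reg : 2 * eta *
    \sum_(1 <= k < K.+1) (hsurrogate f (x k) (P k) - hsurrogate f (x k) C) <=
    frob_norm (P 1%N - C) ^+ 2 + K%:R * (eta * (L * D + 1)) ^+ 2.
  apply: (ogd_regret (h := fun k => hsurrogate f (x k))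
    (G := fun k => grad (hsurrogate f (x k)) (P k)) cPs (ltW eta0) PC).
  move=> k kK; have [_ prk] := run kK.
  have Pk : Ps (P k) by apply: osgm_mem; case/andP: kK => -> /leqW.
  split => //.
    exact: (hsurrogate_subgradient _ mu0 fmu).
  apply: (grad_hsurrogate_norm mu0 L0 fmu fL) => //.
    exact: osgm_grad_neq0.
  (* As 0 lies in [Ps], the diameter also bounds the norm of [P k]. *)
  by rewrite -[P k]subr0; apply: frob_diam_le.
have P1C : frob_norm (P 1%N - C) ^+ 2 <= D ^+ 2.
  by rewrite lerXn2r ?nnegrE ?frob_norm_ge0 ?(ltW D0) // frob_diam_le.
(* After scaling by [2 * eta], the choice [eta (L D + 1) sqrt K = 2 D] bounds the left side by
   [D^2 + 4 D^2], while [2 eta rho = 8 D^2]. *)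
rewrite -(ler_pM2l (mulr_gt0 (ltr0n R 2) eta0)); apply: (le_trans reg).
have -> : K%:R * (eta * (L * D + 1)) ^+ 2 = (2 * D) ^+ 2.
  by rewrite -etaE -s2; ring.
have -> : 2 * eta * rho = 4 * D * (2 * D).
  by rewrite -[in RHS]etaE /rho -/s; ring.
by have := mulr_gt0 D0 D0; move: P1C; rewrite !expr2; lra.
Qed.

(** The regret bound holds against every [C] in [Ps], so it passes to the infimum, attained or
    not. *)
Lemma osgm_theta :
  K%:R^-1 * (\sum_(1 <= k < K.+1) hsurrogate f (x k) (P k) - rho) <=
  theta_star f Ps K x.
Proof.
apply: lb_le_inf.
  by exists (K%:R^-1 * \sum_(1 <= k < K.+1) hsurrogate f (x k) 0), 0.
move=> _ [C PC <-]; rewrite ler_wpM2l ?invr_ge0 //.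
exact: osgm_regret.
Qed.

Lemma osgm_progress_ge0 k : 0 <= a k.
Proof. by rewrite le_max lexx orbT. Qed.

Lemma osgm_gain_ge0 : 0 <= gain.
Proof. by rewrite le_max lexx orbT. Qed.

(** Both entries of the maximum in [gain] are at most the average of the [a k]: 0 because
    [a k >= 0], the other because [a k] dominates the negated surrogate value. *)
Lemma osgm_gain_le : K%:R * gain <= \sum_(1 <= k < K.+1) a k.
Proof.
have sum_a0 : 0 <= \sum_(1 <= k < K.+1) a k.
  by apply: sumr_ge0 => k _; apply: osgm_progress_ge0.
have KR : (0 : R) < K%:R by rewrite ltr0n.
rewrite -ler_pdivlMl // ge_max mulr_ge0 ?invr_ge0 // andbT.
have sum_a : - (\sum_(1 <= k < K.+1) hsurrogate f (x k) (P k)) <=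
    \sum_(1 <= k < K.+1) a k.
  by rewrite -sumrN ler_sum // => k _; rewrite le_max lexx.
have iK : (0 : R) <= K%:R^-1 by rewrite invr_ge0 ltW.
have := osgm_theta; have := ler_wpM2l iK sum_a.
by rewrite mulrBr [rho / _]mulrC mulrN; lra.
Qed.

(** The two bounds of the oracle match the two branches of the maximum in [a k]. *)
Lemma osgm_descent k : (1 <= k <= K)%N ->
  f (x k.+1) <= f (x k) - frob_norm (grad f (x k)) ^+ 2 * a k.
Proof.
move=> kK; have [-> _] := run kK.
have Pk : Ps (P k) by apply: osgm_mem; case/andP: kK => -> /leqW.
have := hM Pk (x k); rewrite le_min => /andP[fx fstep].
rewrite /a /Num.max; case: ifP => _; first by rewrite mulr0 subr0.
have hE : frob_norm (grad f (x k)) ^+ 2 * hsurrogate f (x k) (P k) =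
    f (x k - P k *m grad f (x k)) - f (x k).
  rewrite mulrC divfK // sqr_frob_norm frob_inner_eq0.
  exact: osgm_grad_neq0.
by rewrite mulrN opprK hE; move: fstep; lra.
Qed.

Lemma osgm_monotone k : (1 <= k <= K.+1)%N -> f (x k) <= f (x 1%N).
Proof.
elim: k => // -[_ //|k IH] kK; apply: (le_trans _ (IH _)); last exact: ltnW.
apply: (le_trans (osgm_descent _)) => //.
by rewrite lerBlDr lerDl mulr_ge0 ?sqr_ge0 ?osgm_progress_ge0.
Qed.

(** * Convergence rates relative to a minimizer *)

Variables (xstar : 'cV[R]_n) (fxstar : minimizers f xstar).

Lemma osgm_gap_gt0 k : (1 <= k <= K)%N -> 0 < f (x k) - f xstar.
Proof.
move=> kK; rewrite subr_gt0 ltNge; apply/negP => fk; apply: (hx kK) => y.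
exact: le_trans (fxstar y).
Qed.

(** By Polyak-Lojasiewicz, step [k] contracts the gap by the factor [1 - 2 * mu * a k]. *)
Lemma osgm_linear :
  f (x K.+1) - f xstar <= (f (x 1%N) - f xstar) * (1 - 2 * mu * gain) ^+ K.
Proof.
apply: (linear_rate (d := fun k => f (x k) - f xstar)
  (a := fun k => 2 * mu * a k)) => //.
- move=> k kK; split; first exact: osgm_gap_gt0.
  have := ler_wpM2r (osgm_progress_ge0 k)
    (polyak_lojasiewicz (x k) xstar mu0 fmu).
  by have := osgm_descent kK; lra.
- by rewrite subr_ge0.
by rewrite -mulr_sumr mulrCA ler_wpM2l ?osgm_gain_le ?mulr_ge0.
Qed.

Lemma osgm_best_grad :
  (\big[mine/+oo]_(1 <= k < K.+1) (frob_norm (grad f (x k)) ^+ 2)%:E <=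
    ediv_infty ((f (x 1%N) - f xstar) / K%:R)%:E gain)%E.
Proof.
rewrite /ediv_infty; case: eqP => [_|/eqP gain0]; first by rewrite leey.
have gain_gt0 : 0 < gain by rewrite lt_def gain0 osgm_gain_ge0.
have [|k kK gk] := @best_iterate_rate R (fun k => f (x k))
  (fun k => frob_norm (grad f (x k)) ^+ 2) a K K0.
  by move=> k kK; split; [exact: osgm_progress_ge0 | exact: osgm_descent].
apply: (@bigmin_inf_seq _ _ _ _ _ k) => //; first by rewrite mem_index_iota.
(* With the denominators cleared, [K * gain] is replaced by the larger sum of the [a k], and
   [f (x K.+1)] by the smaller [f xstar]. *)
rewrite -EFinM lee_fin ler_pdivlMr // ler_pdivlMr ?ltr0n // -mulrA.
rewrite [gain * _]mulrC.
have := ler_wpM2l (sqr_ge0 (frob_norm (grad f (x k)))) osgm_gain_le.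
by have := fxstar (x K.+1); move: gk => /=; lra.
Qed.

(** Convexity puts every minimizer at distance at least gap over gradient norm from [x k], and
    monotonicity keeps [x k] in the initial level set. The quotient form stays meaningful when the
    radius is infinite. *)
Lemma osgm_level_radius k : (1 <= k <= K)%N ->
  (((f (x k) - f xstar) / frob_norm (grad f (x k)))%:E <=
    level_radius f (x 1%N))%E.
Proof.
move=> kK; have g0 : 0 < frob_norm (grad f (x k)).
  exact: osgm_grad_gt0.
apply: (@le_trans _ _ (dist_minimizers f (x k))).
  apply: le_ereal_inf_tmp => _ [y fy <-]; rewrite lee_fin ler_pdivrMr // mulrC.
  apply: le_trans (gap_le_grad_dist _ _ mu0 fmu).
  by rewrite lerB // fxstar.
apply: ereal_sup_ubound; exists (x k) => //=.
by apply: osgm_monotone; case/andP: kK => -> /leqW.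
Qed.

Lemma osgm_sublinear :
  ((f (x K.+1) - f xstar)%:E <=
    ediv_infty (level_radius f (x 1%N) ^+ 2 * (K%:R^-1)%:E) gain)%E.
Proof.
rewrite /ediv_infty; case: eqP => [_|/eqP gain0]; first by rewrite leey.
have gain_gt0 : 0 < gain by rewrite lt_def gain0 osgm_gain_ge0.
have KR : (0 : R) < K%:R by rewrite ltr0n.
(* A radius +oo makes the right-hand side +oo, and -oo is excluded by the lower bound at [k = 1];
   only a finite radius [r] needs the recursion. *)
have := osgm_level_radius; case: (level_radius f (x 1%N)) => [r|_|/(_ 1%N)].
- move=> rk.
  have r0 : 0 < r.
    rewrite -lte_fin; apply: lt_le_trans (rk 1%N _); last by rewrite K0.
    by rewrite lte_fin divr_gt0 ?osgm_grad_gt0 ?osgm_gap_gt0 ?K0.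
  have r2 : 0 < r ^+ 2 by rewrite exprn_gt0.
  (* The weights [a k / r ^+ 2] arise from [(gap / r) ^+ 2 <= |grad f (x k)| ^+ 2] inserted in the
     descent inequality. *)
  have rate : (f (x K.+1) - f xstar) * \sum_(1 <= k < K.+1) (a k / r ^+ 2) <= 1.
    apply: (sublinear_rate (d := fun k => f (x k) - f xstar)) => [k kK|];
      last by rewrite subr_ge0.
    have gap0 := osgm_gap_gt0 kK.
    split=> //; first by rewrite divr_ge0 ?osgm_progress_ge0 ?ltW.
    have : (f (x k) - f xstar) ^+ 2 / r ^+ 2 <= frob_norm (grad f (x k)) ^+ 2.
      rewrite ler_pdivrMr // -exprMn.
      rewrite lerXn2r ?nnegrE ?mulr_ge0 ?frob_norm_ge0 ?(ltW gap0) ?(ltW r0) //.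
      by rewrite mulrC -ler_pdivrMr ?osgm_grad_gt0 // -lee_fin rk.
    move=> /(ler_wpM2r (osgm_progress_ge0 k)).
    by have := osgm_descent kK; rewrite [_ / _ * _]mulrAC -mulrA; lra.
  move: rate; rewrite -mulr_suml => rate.
  rewrite -EFin_expe -!EFinM lee_fin ler_pdivlMr // ler_pdivlMr //.
  move: rate; rewrite mulrA ler_pdivrMr // mul1r -mulrA [gain * _]mulrC.
  apply: le_trans; rewrite ler_wpM2l ?osgm_gain_le //.
  by rewrite subr_ge0.
- by rewrite expe2 mulyy gt0_mulye ?lte_fin ?invr_gt0 // gt0_mulye ?leey //
    lte_fin invr_gt0.
- by rewrite K0 => /(_ isT); rewrite leeNy_eq.
Qed.

End OSGM.

Theorem theorem6p1 (R : realType) (n : nat) (f : 'cV[R]_n -> R)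
    (L mu : R) (hL : 0 < L) (hmu : 0 <= mu)
    (hf2 : twice_differentiable f)
    (hsmooth : smooth L f) (hconv : strongly_convex mu f)
    (xstar : 'cV[R]_n) (hxstar : minimizers f xstar)
    (Ps : set 'M[R]_n) (D : R) (hD : 0 < D)
    (hPsclosed : closed Ps) (hPsconvex : @convex_set R 'M[R]_n Ps)
    (hPs0 : Ps 0) (hPsL : Ps (L^-1)%:M) (hPsdiam : (frob_diam Ps <= D%:E)%E)
    (M : 'M[R]_n -> 'cV[R]_n -> 'cV[R]_n)
    (hM : forall P, Ps P -> monotone_descent_oracle f P (M P))
    (K : nat) (hK : (1 <= K)%N)
    (x : nat -> 'cV[R]_n) (P : nat -> 'M[R]_n) (hP1 : Ps (P 1%N))
    (hrun : OSGM_H f Ps M (2 * D / ((L * D + 1) * Num.sqrt K%:R)) K x P)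
    (hx : forall k, (1 <= k <= K)%N -> ~ minimizers f (x k)) :
  let rho := 2 * D * (L * D + 1) * Num.sqrt K%:R in
  let gain := Num.max (- theta_star f Ps K x - rho / K%:R) 0 in
  (0 < mu ->
     f (x K.+1) - f xstar <=
     (f (x 1%N) - f xstar) * (1 - 2 * mu * gain) ^+ K) /\
  ((\big[mine/+oo]_(1 <= k < K.+1) (frob_norm (grad f (x k)) ^+ 2)%:E <=
      ediv_infty ((f (x 1%N) - f xstar) / K%:R)%:E gain)%E /\
   ((f (x K.+1) - f xstar)%:E <=
      ediv_infty (level_radius f (x 1%N) ^+ 2 * (K%:R^-1)%:E) gain)%E).
Proof.
have df := hf2.1; move=> rho gain; split=> [_|].
  exact: (osgm_linear hL hmu hD hK df hsmooth hconv hPsconvex hPs0 hPsdiam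
    hM hP1 hrun hx hxstar).
split.
  exact: (osgm_best_grad hL hmu hD hK df hsmooth hconv hPsconvex hPs0 hPsdiam
    hM hP1 hrun hx hxstar).
exact: (osgm_sublinear hL hmu hD hK df hsmooth hconv hPsconvex hPs0 hPsdiam
  hM hP1 hrun hx hxstar).
Qed.
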